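(* Let $d\in\{0,\dots,n+1\}$ and $\epsilon,\tilde\epsilon\in\mathbb{Z}_2^{n+1}$ with $|\epsilon|=|\tilde\epsilon|=d$. For $i\in\{0,\dots,n\}$, we have $$D_{i,i}^{\mathsf t,\tilde\xi}\,\tilde{\mathcal{P}}_{\bar1}^{\wedge}(\epsilon)=\epsilon_i\,\tilde{\mathcal{P}}_{\bar1}^{\wedge}(\epsilon),\qquad \tilde D_{i,i}^{\mathsf t,\xi}\,\mathcal{P}_{\bar1}^{\wedge}(\tilde\epsilon)=\tilde\epsilon_i\,\mathcal{P}_{\bar1}^{\wedge}(\tilde\epsilon).$$ Furthermore, $$\Big(d-\sum_{i=1}^nD_{i,i}^{\mathsf t,\tilde\xi}\Big)\tilde{\mathcal{P}}_{\bar1}^{\wedge}(\epsilon)=\epsilon_0\,\tilde{\mathcal{P}}_{\bar1}^{\wedge}(\epsilon),\qquad \Big(d-\sum_{i=1}^n\tilde D_{i,i}^{\mathsf t,\xi}\Big)\mathcal{P}_{\bar1}^{\wedge}(\tilde\epsilon)=\tilde\epsilon_0\,\mathcal{P}_{\bar1}^{\wedge}(\tilde\epsilon).$$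
   Context: Let $n\in\mathbb{Z}_{\ge0}$ and $\Lambda=(q,\tilde q,V)$ with $q,\tilde q\in\mathbb{C}^{n+1}$ and $V=(v_{i,j})_{i,j=0}^n$ a complex matrix such that $q_0=\tilde q_0\ne0$, $v_{0,j}=v_{i,0}=1$ for all $i,j$, and $QV\tilde QV^{\mathsf t}=q_0I_{n+1}$, where $Q=\mathrm{diag}(q)$, $\tilde Q=\mathrm{diag}(\tilde q)$. Here $\mathbb{Z}_2=\{0,1\}$ and $|\epsilon|=\sum_i\epsilon_i$. Odd Krawtchouk polynomials (degree $d$): $\mathcal{P}_{\bar1}(\epsilon,\tilde\epsilon)=\frac1{d!}\sum_{|I|=|J|=d}\det A_{I,J}(\epsilon,\tilde\epsilon)$, where $A(\epsilon,\tilde\epsilon)=\mathrm{diag}(\tilde\epsilon)V\mathrm{diag}(\epsilon)$, $I,J$ range over size-$d$ subsets of $\{0,\dots,n\}$, and $A_{I,J}$ is the submatrix with rows $I$ and columns $J$ (in increasing order). When $\epsilon$ (resp. $\tilde\epsilon$) is fixed, this is regarded as a polynomial $\mathcal{P}_{\bar1}(\epsilon,-)$ in formal variables $\tilde\epsilon_0,\dots,\tilde\epsilon_n$ (resp. $\mathcal{P}_{\bar1}(-,\tilde\epsilon)$ in $\epsilon_0,\dots,\epsilon_n$), homogeneous of degree $d$ and linear in each variable. Exterior algebra. Let $\xi_0,\dots,\xi_n$ be anticommuting variables (a basis of $\mathcal{W}$), and $\mathcal{F}^{(d)}=\bigwedge^d\mathcal{W}$. Choose $\tilde\kappa\in\mathbb{C}$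 with $\det(\tilde\kappa\tilde QV^{\mathsf t})=1$ and set $\tilde\xi_j=\tilde\kappa\sum_{k=0}^n\tilde q_kv_{j,k}\xi_k$, another basis of $\mathcal{W}$. For $I=\{i_0<\dots<i_{d-1}\}$ write $\xi_I=\xi_{i_0}\cdots\xi_{i_{d-1}}$, $\tilde\xi_I=\tilde\xi_{i_0}\cdots\tilde\xi_{i_{d-1}}$, $\epsilon_I=\prod_{i\in I}\epsilon_i$, $\tilde\epsilon_I=\prod_{i\in I}\tilde\epsilon_i$. Let $\tilde A_d$ (resp. $A_d$) be the space of homogeneous degree $d$ polynomials in the $\tilde\epsilon_j$ (resp. the $\epsilon_j$) that are linear in each variable, and define linear isomorphisms $\tilde\psi:\tilde A_d\to\mathcal{F}^{(d)}$, $\sum_Ic_I\tilde\epsilon_I\mapsto\sum_Ic_I\tilde\xi_I$, and $\psi:A_d\to\mathcal{F}^{(d)}$, $\sum_Ic_I\epsilon_I\mapsto\sum_Ic_I\xi_I$. Put $\tilde{\mathcal{P}}_{\bar1}^{\wedge}(\epsilon)=\tilde\psi(\mathcal{P}_{\bar1}(\epsilon,-))$ and $\mathcal{P}_{\bar1}^{\wedge}(\tilde\epsilon)=\psi(\mathcal{P}_{\bar1}(-,\tilde\epsilon))$. Operators. On $\mathcal{F}^{(d)}$, $D_{i,i}$ acts as $\xi_i\partial_{\xi_i}$ and $\tilde D_{i,i}$ acts as $\tilde\xi_i\partial_{\tilde\xi_i}$, where $\partial_{\xi_i}$, $\partial_{\tilde\xi_i}$ are the left superderivations (contractions) dual to the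 bases $\{\xi_j\}$, $\{\tilde\xi_j\}$ respectively. For a linear operator $X$ on $\mathcal{F}^{(d)}$, $X^{\mathsf t,\tilde\xi}$ (resp. $X^{\mathsf t,\xi}$) denotes the operator whose matrix in the basis $\{\tilde\xi_I:|I|=d\}$ (resp. $\{\xi_I:|I|=d\}$) is the transpose of the matrix of $X$ in that basis. *)

(* Defs.v *)
From HB Require Import structures.
From mathcomp Require Import all_boot all_order all_algebra.
From mathcomp Require Import mpoly ring.

Set Implicit Arguments.
Unset Strict Implicit.
Unset Printing Implicit Defensive.

Import Order.TTheory GRing.Theory.
Local Open Scope ring_scope.

(** * Exterior algebra on anticommuting generators xi_0, ..., xi_(m-1) *)

(* An element is its family of coordinates in the monomial basis
   xi_I = xi_(i_0) ... xi_(i_(d-1)), I = {i_0 < ... < i_(d-1)}. *)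
Definition ext (F : fieldType) (m : nat) : Type := {ffun {set 'I_m} -> F^o}.

HB.instance Definition _ (F : fieldType) (m : nat) :=
  Vector.copy (ext F m) {ffun {set 'I_m} -> F^o}.

Section ExteriorAlgebra.
Variables (F : fieldType) (m : nat).
Local Notation E := (ext F m).
Implicit Types (I J K H : {set 'I_m}) (x y z : E) (i j k l : 'I_m).

Definition inversions I J : nat := (\sum_(i in I) \sum_(j in J) (j < i))%N.

(* For disjoint I and J, xi_I xi_J = extsign I J * xi_(I :|: J). *)
Definition extsign I J : F := (-1) ^+ inversions I J.

Definition extmon I : E := [ffun K : {set 'I_m} => (K == I)%:R].

Definition extmul x y : E :=
  [ffun K : {set 'I_m} => \sum_(I : {set 'I_m} | I \subset K)
               extsign I (K :\: I) * (x I * y (K :\: I))].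

Lemma inversions_setDl I J K : J \subset I ->
  inversions I K = (inversions J K + inversions (I :\: J) K)%N.
Proof.
by move=> sJI; rewrite /inversions (big_setID J) /= (setIidPr sJI).
Qed.

Lemma inversions_setDr I J K : J \subset I ->
  inversions K I = (inversions K J + inversions K (I :\: J))%N.
Proof.
move=> sJI; rewrite /inversions -big_split /=; apply: eq_bigr => i _.
by rewrite (big_setID J) /= (setIidPr sJI).
Qed.

Lemma extsign_setDl I J K : J \subset I ->
  extsign I K = extsign J K * extsign (I :\: J) K.
Proof. by move=> sJI; rewrite /extsign (inversions_setDl _ sJI) exprD. Qed.

Lemma extsign_setDr I J K : J \subset I ->
  extsign K I = extsign K J * extsign K (I :\: J).
Proof. by move=> sJI; rewrite /extsign (inversions_setDr _ sJI) exprD. Qed.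

Lemma extsign0s I : extsign set0 I = 1.
Proof. by rewrite /extsign /inversions big_set0. Qed.

Lemma extsigns0 I : extsign I set0 = 1.
Proof. by rewrite /extsign /inversions big1 // => i _; rewrite big_set0. Qed.

Lemma extmulA : associative extmul.
Proof.
move=> x y z; apply/ffunP=> K; rewrite !ffunE.
transitivity (\sum_(I : {set 'I_m}) \sum_(H : {set 'I_m} | (H \subset I) && (I \subset K))
   extsign H (I :\: H) * extsign H (K :\: I) * extsign (I :\: H) (K :\: I)
   * (x H * y (I :\: H) * z (K :\: I))); last first.
  rewrite [RHS]big_mkcond; apply: eq_bigr => I _; case: ifP => sIK; last first.
    by rewrite big1 // => H /andP[].
  rewrite ffunE mulr_suml mulr_sumr; apply: eq_big => [H|H /andP[sHI _]].
    by rewrite andbT.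
  by rewrite (extsign_setDl _ sHI); ring.
rewrite (exchange_big_dep xpredT) //= [LHS]big_mkcond; apply: eq_bigr => H _.
case: ifP => sHK; last first.
  rewrite big1 // => I /andP[sHI sIK].
  by rewrite (subset_trans sHI sIK) in sHK.
rewrite ffunE !mulr_sumr.
rewrite (reindex_onto (fun I => I :\: H) (fun J => H :|: J)) /=; last first.
  move=> J /subsetDP[_ dJ]; rewrite setDUl setDv set0U.
  by apply/setDidPl.
apply: eq_big => [I|I /andP[sIK /eqP eI]].
  apply/andP/andP=> [[sIK /eqP eI]|[sHI sIK]].
    rewrite -eI subsetUl; split=> //; rewrite subUset sHK /=.
    exact: subset_trans sIK (subsetDl _ _).
  split; first exact: setSD.
  by rewrite -{1}(setIidPr sHI) setID.
have sHI : H \subset I by rewrite -eI subsetUl.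
have eKI : K :\: H :\: (I :\: H) = K :\: I.
  by rewrite setDDl eI.
rewrite (extsign_setDr _ sIK) eKI.
ring.
Qed.

Lemma extmul1l : left_id (extmon set0) extmul.
Proof.
move=> x; apply/ffunP=> K; rewrite ffunE (bigD1 set0) ?sub0set //=.
rewrite big1 ?addr0 => [|I /andP[_ /negPf nI]]; last first.
  by rewrite ffunE nI mul0r mulr0.
by rewrite ffunE eqxx setD0 extsign0s !mul1r.
Qed.

Lemma extmul1r : right_id (extmon set0) extmul.
Proof.
move=> x; apply/ffunP=> K; rewrite ffunE (bigD1 K) //=.
rewrite big1 ?addr0 => [|I /andP[sIK nI]]; last first.
  rewrite ffunE setD_eq0; case: (boolP (K \subset I)) => [sKI|_].
    by rewrite eqEsubset sIK sKI in nI.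
  by rewrite !mulr0.
by rewrite ffunE setDv eqxx extsigns0 mul1r mulr1.
Qed.

Lemma extmulDl : left_distributive extmul +%R.
Proof.
move=> x y z; apply/ffunP=> K; rewrite !ffunE -big_split.
by apply: eq_bigr => I _; rewrite ffunE /= mulrDl mulrDr.
Qed.

Lemma extmulDr : right_distributive extmul +%R.
Proof.
move=> x y z; apply/ffunP=> K; rewrite !ffunE -big_split.
by apply: eq_bigr => I _; rewrite ffunE /= mulrDr mulrDr.
Qed.

Lemma extmon0_neq0 : extmon set0 != 0.
Proof.
apply/eqP=> /ffunP/(_ set0)/eqP.
by rewrite !ffunE eqxx oner_eq0.
Qed.

HB.instance Definition _ := GRing.Zmodule_isNzRing.Build E
  extmulA extmul1l extmul1r extmulDl extmulDr extmon0_neq0.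

Lemma extscaleAl (a : F) x y : a *: (x * y) = (a *: x) * y.
Proof.
apply/ffunP=> K; rewrite !ffunE /= scaler_sumr; apply: eq_bigr => I _.
by rewrite ffunE /GRing.scale /=; ring.
Qed.

HB.instance Definition _ := GRing.Lmodule_isLalgebra.Build F E extscaleAl.

Lemma extscaleAr (a : F) x y : a *: (x * y) = x * (a *: y).
Proof.
apply/ffunP=> K; rewrite !ffunE /= scaler_sumr; apply: eq_bigr => I _.
by rewrite ffunE /GRing.scale /=; ring.
Qed.

HB.instance Definition _ := GRing.Lalgebra_isAlgebra.Build F E extscaleAr.

Definition xi : m.-tuple E := [tuple extmon [set k] | k < m].

(* b_I = b_(i_0) ... b_(i_(d-1)); enum I is increasing. *)
Definition wedge (b : m.-tuple E) I : E := \prod_(i <- enum I) tnth b i.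

(* The left superderivation of degree -1 extending f on the span W of the
   xi_k, for f linear:
   xi_I |-> \sum_(k in I) (-1)^#|{j in I | j < k}| * f (xi_k) *: xi_(I :\ k). *)
Definition contraction (f : E -> F) x : E :=
  [ffun K : {set 'I_m} =>
     \sum_(k | k \notin K) extsign [set k] K * f (tnth xi k) * x (k |: K)].

(* If b is a basis of W, then coord b i is the linear form on W dual to b_i. *)
Definition partial (b : m.-tuple E) i : E -> E := contraction (coord b i).

Lemma tnth_xi k : tnth xi k = extmon [set k].
Proof. by rewrite tnth_mktuple. Qed.

Lemma extmon_mul I J : extmon I * extmon J =
  if [disjoint I & J] then extsign I J *: extmon (I :|: J) else 0.
Proof.
apply/ffunP=> K; rewrite ffunE big_mkcond (bigD1 I) //= big1 ?addr0; last first.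
  by move=> H /negPf nHI; rewrite ffunE nHI mul0r mulr0 if_same.
rewrite !ffunE eqxx mul1r.
case: ifP => [sIK|nsIK]; last first.
  case: ifP => _; rewrite ?ffunE // /GRing.scale /=.
  by case: eqP nsIK => [->|_]; rewrite ?subsetUl ?mulr0.
case: (eqVneq (K :\: I) J) => [<-|nJ].
  have -> : [disjoint I & K :\: I] by rewrite -setI_eq0 setDE setICA setICr setI0.
  rewrite !ffunE /GRing.scale /=; congr (_ * _).
  have -> : I :|: K :\: I = K by rewrite -{1}(setIidPr sIK) setID.
  by rewrite eqxx.
rewrite mulr0; case: ifP => dIJ; rewrite ffunE // /GRing.scale /=.
rewrite ffunE; case: (K =P I :|: J) nJ => [->|_]; last by rewrite mulr0.
rewrite setDUl setDv set0U => /eqP []; apply/setDidPl.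
by rewrite disjoint_sym.
Qed.

Lemma xi_sqr k : tnth xi k * tnth xi k = 0.
Proof. by rewrite tnth_xi extmon_mul disjoints1 set11. Qed.

Lemma extsign1 k J : extsign [set k] J = (-1) ^+ (\sum_(j in J) (j < k))%N.
Proof. by rewrite /extsign /inversions big_set1. Qed.

Lemma extsign11 k l : extsign [set k] [set l] = (-1) ^+ (l < k).
Proof. by rewrite extsign1 big_set1. Qed.

Lemma xi_anticomm k l : tnth xi k * tnth xi l = - (tnth xi l * tnth xi k).
Proof.
have [->|nkl] := eqVneq k l; first by rewrite xi_sqr oppr0.
rewrite !tnth_xi !extmon_mul !disjoints1 !inE nkl eq_sym nkl.
rewrite !extsign11 setUC -scaleNr.
by move: nkl; rewrite -val_eqE neq_ltn => /orP[] lt_kl;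
  rewrite lt_kl ltnNge ltnW //= ?opprK.
Qed.

Lemma wedge_xi I : wedge xi I = extmon I.
Proof.
rewrite /wedge.
have {2}-> : I = [set i in enum I] by apply/setP=> i; rewrite inE mem_enum.
have : sorted (fun i j => (i < j)%N) (enum I).
  rewrite {1}/enum_mem -enumT; apply: sorted_filter.
    by move=> i j k; apply: ltn_trans.
  by have := iota_ltn_sorted 0 m; rewrite -val_enum_ord sorted_map.
elim: (enum I) => [_|k s IHs /= ps].
  by rewrite big_nil; congr extmon; apply/setP=> i; rewrite !inE.
have lts : all (fun j => (k < j)%N) s.
  by apply: order_path_min ps => i j l; apply: ltn_trans.
rewrite big_cons IHs ?(path_sorted ps) // tnth_xi extmon_mul.
have nks : k \notin s by apply/negP=> /(allP lts); rewrite ltnn.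
rewrite disjoints1 inE nks extsign1 big1 ?expr0 ?scale1r.
  by congr extmon; apply/setP=> i; rewrite !inE.
by move=> j; rewrite inE => /(allP lts) ltkj; rewrite ltnNge ltnW.
Qed.

Lemma contraction1 (f : E -> F) : contraction f 1 = 0.
Proof.
apply/ffunP=> K; rewrite !ffunE big1 // => k nkK.
rewrite ffunE; case: eqP => [/setP/(_ k)|_]; last by rewrite mulr0.
by rewrite !inE eqxx.
Qed.

Lemma xi_mulE k x K :
  (tnth xi k * x) K =
    if k \in K then extsign [set k] (K :\ k) * x (K :\ k) else 0.
Proof.
rewrite tnth_xi ffunE big_mkcond (bigD1 [set k]) //= big1 ?addr0.
  by rewrite sub1set ffunE eqxx mul1r.
by move=> H /negPf nH; rewrite ffunE nH mul0r mulr0 if_same.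
Qed.

Lemma contraction_xi_mul (f : E -> F) k x :
  contraction f (tnth xi k * x)
    = f (tnth xi k) *: x - tnth xi k * contraction f x.
Proof.
have subE (u v : E) H : (u - v) H = u H - v H by rewrite !ffunE.
have scaleE (a : F) (u : E) H : (a *: u) H = a * u H by rewrite ffunE.
apply/ffunP=> K; rewrite subE scaleE ffunE.
rewrite xi_mulE.
under eq_bigr do rewrite xi_mulE.
case: (boolP (k \in K)) => kK; last first.
  rewrite subr0 (bigD1 k) //= big1 ?addr0 => [|l /andP[lK nlk]]; last first.
    by rewrite !inE eq_sym (negPf nlk) (negPf kK) mulr0.
  rewrite !inE eqxx /= setU1K // -[RHS]mul1r -(sqrr_sign F (inversions [set k] K)).
  by rewrite -/(extsign _ _); ring.
rewrite [contraction f x _]ffunE [X in _ = _ - _ * X](bigD1 k) /=; last by rewrite !inE eqxx.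
rewrite setD1K // mulrDr opprD addrA.
have sq I J : extsign I J * extsign I J = 1 by rewrite -expr2 sqrr_sign.
rewrite !mulrA sq mul1r subrr add0r mulr_sumr -sumrN.
apply: eq_big => [l|l lK].
  by rewrite !inE; case: (eqVneq l k) => [->|]; rewrite ?kK //= andbT.
have nlk : l != k by apply: contraNneq lK => ->.
rewrite !inE kK orbT.
have -> : (l |: K) :\ k = l |: (K :\ k).
  apply/setP=> j; rewrite !inE; case: (eqVneq j l) => [->|] //=.
  by rewrite nlk.
rewrite (@extsign_setDr K [set k]) ?sub1set //.
rewrite (@extsign_setDr (l |: K :\ k) [set l] [set k]) ?subsetUl //.
have -> : (l |: K :\ k) :\: [set l] = K :\ k.
  by rewrite setU1K // !inE (negPf lK) andbF.
rewrite !extsign11.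
by move: nlk; rewrite -val_eqE neq_ltn => /orP[] lt_lk;
  rewrite lt_lk ltnNge ltnW //=; ring.
Qed.

End ExteriorAlgebra.

Section ExteriorPowers.
Variables (F : fieldType) (m : nat).
Local Notation E := (ext F m).
Implicit Types (I J K : {set 'I_m}) (x : E) (b : m.-tuple E) (d : nat).

Definition dsubsets d : {set {set 'I_m}} := [set I : {set 'I_m} | #|I| == d].

(* F^(d) as a subspace of the exterior algebra; W = extpow 1. *)
Definition extpow d : {vspace E} :=
  <<map (wedge (xi F m)) (enum (dsubsets d))>>%VS.

Definition wedge_pow b d I : subvs_of (extpow d) :=
  vsproj (extpow d) (wedge b I).

Definition pow_basis b d : #|dsubsets d|.-tuple (subvs_of (extpow d)) :=
  [tuple of map (wedge_pow b d) (enum_tuple (dsubsets d))].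

(* The operator b_i \partial_(b_i), restricted to F^(d). *)
Definition diag_op b d (i : 'I_m) : 'End(subvs_of (extpow d)) :=
  linfun (fun v => vsproj (extpow d) (tnth b i * partial b i (vsval v))).

Let addE (u v : E) K : (u + v) K = u K + v K.
Proof. by rewrite ffunE. Qed.

Let scaleE (a : F) (u : E) K : (a *: u) K = a * u K.
Proof. by rewrite ffunE. Qed.

Let sumE (T : Type) (r : seq T) (P : pred T) (G : T -> E) K :
  (\sum_(t <- r | P t) G t) K = \sum_(t <- r | P t) G t K.
Proof. exact: (big_morph (fun u : E => u K) (fun u v => addE u v K) (ffunE _ _)). Qed.

Lemma ext_sum_extmon x : x = \sum_(I : {set 'I_m}) x I *: extmon F I.
Proof.
apply/ffunP=> K; rewrite sumE (bigD1 K) //= big1 ?addr0.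
  by rewrite scaleE ffunE eqxx mulr1.
by move=> I nIK; rewrite scaleE ffunE eq_sym (negPf nIK) mulr0.
Qed.

Lemma mem_extpowP d x :
  reflect (forall K, #|K| != d -> x K = 0) (x \in extpow d).
Proof.
apply: (iffP idP) => [xd K nKd|x0].
  rewrite (coord_span (X := in_tuple _) xd) sumE big1 // => i _.
  rewrite scaleE [X in _ * X](_ : _ = 0) ?mulr0 //.
  have /mapP[I] := mem_nth 0 (ltn_ord i).
  rewrite mem_enum inE => /eqP dI ->; rewrite wedge_xi ffunE.
  by case: (K =P I) nKd => // ->; rewrite dI eqxx.
rewrite (ext_sum_extmon x); apply: rpred_sum => I _.
have [dI|nI] := eqVneq #|I| d; last by rewrite x0 // scale0r rpred0.
apply/rpredZ/memv_span; rewrite -wedge_xi.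
by apply: map_f; rewrite mem_enum inE dI.
Qed.

Lemma xi_mul_extpow d k x :
  x \in extpow d -> tnth (xi F m) k * x \in extpow d.+1.
Proof.
move=> /mem_extpowP xd; apply/mem_extpowP=> K nKd; rewrite xi_mulE.
case: ifP => // kK; rewrite xd ?mulr0 //.
by rewrite (cardsD1 k K) kK in nKd.
Qed.

Lemma contraction_extpow d (f : E -> F) x :
  x \in extpow d.+1 -> contraction f x \in extpow d.
Proof.
move=> /mem_extpowP xd; apply/mem_extpowP=> K nKd; rewrite ffunE big1 // => k nkK.
by rewrite xd ?mulr0 // cardsU1 nkK.
Qed.

Lemma contraction_extpow0 (f : E -> F) x :
  x \in extpow 0 -> contraction f x = 0.
Proof.
move=> /mem_extpowP x0; apply/ffunP=> K; rewrite !ffunE big1 // => k nkK.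
by rewrite x0 ?mulr0 // cardsU1 nkK.
Qed.

Lemma extpow1_mul d x y :
  x \in extpow 1 -> y \in extpow d -> x * y \in extpow d.+1.
Proof.
move=> /mem_extpowP x1 yd; rewrite (ext_sum_extmon x) mulr_suml.
apply: rpred_sum => I _; rewrite -scalerAl.
have [/eqP/cards1P[k ->]|nI] := eqVneq #|I| 1%N.
  by rewrite -tnth_xi rpredZ ?xi_mul_extpow.
by rewrite x1 // scale0r rpred0.
Qed.

Lemma mem_wedge b I :
  (forall i, tnth b i \in extpow 1) -> wedge b I \in extpow #|I|.
Proof.
move=> bW; rewrite /wedge cardE; elim: (enum I) => [|i s IHs] /=.
  rewrite big_nil; apply/mem_extpowP=> K; rewrite cards_eq0 => nK.
  by rewrite ffunE (negPf nK).
by rewrite big_cons extpow1_mul.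
Qed.

Lemma diag_op_extpow b d i x :
  (forall j, tnth b j \in extpow 1) -> x \in extpow d ->
  tnth b i * partial b i x \in extpow d.
Proof.
case: d => [|d] bW xd; last by rewrite extpow1_mul ?contraction_extpow.
by rewrite /partial contraction_extpow0 // mulr0 rpred0.
Qed.

Lemma pow_basis_xi d : basis_of fullv (pow_basis (xi F m) d).
Proof.
have wv I : #|I| = d -> vsval (wedge_pow (xi F m) d I) = extmon F I.
  move=> dI; rewrite vsprojK ?wedge_xi //; apply/mem_extpowP=> K nKd.
  by rewrite ffunE; case: (K =P I) nKd => // ->; rewrite dI eqxx.
apply/andP; split.
  rewrite eqEsubv subvf /=; apply/subvP=> v _.
  rewrite -[v]vsvalK {1}(ext_sum_extmon (vsval v)) linear_sum.
  apply: rpred_sum => I _; rewrite linearZ; have [dI|nI] := eqVneq #|I| d.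
    apply/rpredZ/memv_span; rewrite -wedge_xi.
    by apply/map_f; rewrite mem_enum inE dI.
  have vI : vsval v I = 0 by move/mem_extpowP: (subvsP v) => ->.
  by rewrite vI /= scale0r rpred0.
apply/freeP=> c c0 i; move: (congr1 vsval c0); rewrite linear_sum linear0.
have dE k : #|tnth (enum_tuple (dsubsets d)) k| = d.
  by apply/eqP; have := mem_tnth k (enum_tuple (dsubsets d)); rewrite mem_enum inE.
have E0 (k : 'I_#|dsubsets d|) : vsval (pow_basis (xi F m) d)`_k
          = extmon F (tnth (enum_tuple (dsubsets d)) k).
  by rewrite -tnth_nth tnth_map wv.
move=> /ffunP/(_ (tnth (enum_tuple (dsubsets d)) i)).
rewrite sumE (bigD1 i) //= big1 ?addr0.
  by have /= -> := E0 i; rewrite scaleE !ffunE eqxx mulr1.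
move=> k nki /=; have /= -> := E0 k.
rewrite scaleE ffunE (inj_eq (tuple_uniqP _ _)).
  by rewrite eq_sym (negPf nki) mulr0.
exact: enum_uniq.
Qed.

End ExteriorPowers.

Section TransposeOperator.
Variables (F : fieldType) (vT : vectType F) (k : nat) (e : k.-tuple vT).

(* Column convention: the j-th column lists the coordinates of X e_j. *)
Definition op_mx (X : 'End(vT)) : 'M[F]_k :=
  \matrix_(i, j) coord e i (X (tnth e j)).

Definition mx_op (M : 'M[F]_k) : 'End(vT) :=
  linfun (fun v => \sum_j coord e j v *: \sum_i M i j *: tnth e i).

Definition transpose_op (X : 'End(vT)) : 'End(vT) := mx_op (op_mx X)^T.

Lemma mx_op_basis (M : 'M[F]_k) j :
  basis_of fullv e -> mx_op M (tnth e j) = \sum_i M i j *: tnth e i.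
Proof.
move=> /basis_free eF; pose f v := \sum_j coord e j v *: \sum_i M i j *: tnth e i.
have fL : linear f.
  move=> a u v; rewrite /f scaler_sumr -big_split; apply: eq_bigr => l _ /=.
  by rewrite linearP scalerDl scalerA.
pose fM := GRing.semilinear_linear fL.
pose g : {linear vT -> vT} := HB.pack f (GRing.isSemilinear.Build F vT vT _ f fM).
rewrite /mx_op (lfunE g) /= /f (bigD1 j) //= (tnth_nth 0) coord_free // eqxx.
rewrite scale1r [X in _ + X]big1 ?addr0 // => l nlj.
by rewrite coord_free // eq_sym (negPf nlj) scale0r.
Qed.

End TransposeOperator.

Section Krawtchouk.
Variables (F : fieldType) (n : nat).
Implicit Types (d : nat) (V : 'M[F]_n.+1) (b : n.+1.-tuple (ext F n.+1)).
Implicit Types (I J : {set 'I_n.+1}) (p : {mpoly F[n.+1]}).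

(* Rows I and columns J, listed in increasing order; meant for #|I| = #|J| = d. *)
Definition minor (K : comNzRingType) d (A : 'M[K]_n.+1) I J : K :=
  \det (mxsub (fun k : 'I_d => nth ord0 (enum I) k)
              (fun k : 'I_d => nth ord0 (enum J) k) A).

(* The odd Krawtchouk polynomial, evaluated in an F-algebra K so that either
   argument may be specialised to formal variables. *)
Definition krawtchouk (K : comAlgType F) d V (e te : 'rV[K]_n.+1) : K :=
  (d`!%:R^-1 : F) *:
    \sum_(I in dsubsets n.+1 d) \sum_(J in dsubsets n.+1 d)
      minor d (diag_mx te *m map_mx (in_alg K) V *m diag_mx e) I J.

(* |eps| = d is stated as \sum_i eps i = d, with bool coerced to nat. *)
Definition bits (K : nzRingType) (eps : {ffun 'I_n.+1 -> bool}) : 'rV[K]_n.+1 :=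
  \row_i (eps i)%:R.

Definition vars : 'rV[{mpoly F[n.+1]}]_n.+1 := \row_i 'X_i.

(* \sum_I c_I X_I |-> \sum_I c_I b_I on polynomials that are homogeneous of
   degree d and linear in each variable; other monomials are dropped. *)
Definition psi b d p : subvs_of (extpow F n.+1 d) :=
  \sum_(I in dsubsets n.+1 d) p@_(mesym1 I) *: wedge_pow b d I.

Definition txi (kappa : F) (tq : 'rV[F]_n.+1) V : n.+1.-tuple (ext F n.+1) :=
  [tuple kappa *: \sum_k (tq 0 k * V j k) *: tnth (xi F n.+1) k | j < n.+1].

Definition tkraw_wedge kappa tq V d eps :=
  psi (txi kappa tq V) d (krawtchouk d V (bits _ eps) vars).

Definition kraw_wedge V d teps :=
  psi (xi F n.+1) d (krawtchouk d V vars (bits _ teps)).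

Lemma krawtchouk_minors (K : comAlgType F) d V (e te : 'rV[K]_n.+1) :
  krawtchouk d V e te =
    \sum_(I in dsubsets n.+1 d) \sum_(J in dsubsets n.+1 d)
      ((d`!%:R^-1 : F) * minor d V I J) *:
         ((\prod_(i in I) te 0 i) * \prod_(j in J) e 0 j).
Proof.
have prodE (u : 'rV[K]_n.+1) (H : {set 'I_n.+1}) : #|H| = d ->
    \prod_(k < d) u 0 (nth ord0 (enum H) k) = \prod_(i in H) u 0 i.
  by move=> <-; rewrite -(big_enum _ _ (mem H)) /= (big_nth ord0) big_mkord -cardE.
rewrite /krawtchouk scaler_sumr; apply: eq_bigr => I; rewrite inE => /eqP dI.
rewrite scaler_sumr; apply: eq_bigr => J; rewrite inE => /eqP dJ.
rewrite -scalerA; congr (_ *: _); rewrite -(prodE _ _ dI) -(prodE _ _ dJ).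
pose f (k : 'I_d) := nth ord0 (enum I) k; pose g (k : 'I_d) := nth ord0 (enum J) k.
rewrite /minor -/f -/g.
have -> : mxsub f g (diag_mx te *m map_mx (in_alg K) V *m diag_mx e)
        = diag_mx (colsub f te) *m map_mx (in_alg K) (mxsub f g V)
          *m diag_mx (colsub g e).
  rewrite !mul_mx_diag !mul_diag_mx; apply/matrixP=> i j.
  by rewrite !mxE.
rewrite !det_mulmx !det_diag det_map_mx /= mulrAC -scalerAr mulr1.
by congr (_ *: (_ * _)); apply: eq_bigr => i _; rewrite mxE.
Qed.

Lemma psi_multilinear b d (c : {set 'I_n.+1} -> F) :
  psi b d (\sum_(I in dsubsets n.+1 d) c I *: \prod_(i in I) 'X_i)
    = \sum_(I in dsubsets n.+1 d) c I *: wedge_pow b d I.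
Proof.
apply: eq_bigr => I dI; congr (_ *: _).
have prodX J : \prod_(j in J) 'X_j = 'X_[mesym1 J] :> {mpoly F[n.+1]}.
  rewrite mpolyXE_id big_mkcond; apply: eq_bigr => j _.
  by rewrite mnmE; case: ifP.
rewrite raddf_sum (bigD1 I) //= mcoeffZ prodX mcoeffX eqxx mulr1.
rewrite big1 ?addr0 // => J /andP[_ nJI].
rewrite mcoeffZ prodX mcoeffX (inj_eq (@inj_mesym1 _)).
by rewrite (negPf nJI) mulr0.
Qed.

End Krawtchouk.

(* Main.v *)
From HB Require Import structures.
Require Import Defs.
From mathcomp Require Import all_boot all_order all_fingroup all_algebra.
From mathcomp Require Import complex reals ring.

Import GRing.Theory.
Local Open Scope ring_scope.

Set Implicit Arguments.
Unset Strict Implicit.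
Unset Printing Implicit Defensive.

(** The two families of identities are one statement, applied twice. Let a and b
be two bases of W with b_i = \sum_j M_ij a_j. Expanding products of
anticommuting elements gives b_I = \sum_K det(M_IK) a_K, so, as I varies, the
minor det(M_IS) is the value at b_I of the linear form l_S that reads off the
coefficient of a_S ([wedge_minors]). The operator a_i \partial_(a_i) is diagonal
in the basis (a_K), with eigenvalue 1 or 0 according to whether i lies in K,
hence l_S (a_i \partial_(a_i) v) = [i \in S] l_S v. An eigenform of an operator X,
written as the vector \sum_I l(b_I) b_I, is precisely an eigenvector of the
transpose of X in the basis (b_I) ([transpose_op_eigenform]); therefore
\sum_I det(M_IS) b_I is an eigenvector of the transpose of
a_i \partial_(a_i), with eigenvalue [i \in S] ([transpose_diag_op_minors]).

When eps is the indicator of S with #|S| = d, the only d-subset J with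
eps_J <> 0 is S, so the wedge form of the polynomial collapses to
(1/d!) \sum_I det(V_IS) txi_I. The matrix expressing txi in terms of xi is
T = V diag(kappa tq), whose minors on the columns S are those of V times the
nonzero constant \prod_(k in S) kappa tq_k: this is the case a = xi, b = txi.
The orthogonality relation says that T has inverse
V^T diag(q) / (kappa q_0), which is again a matrix with scaled columns, V^T
replacing V: this is the case a = txi, b = xi, for the other argument of the
polynomial. The last two identities follow by summing over i <> 0, since the
eigenvalues of all the n + 1 operators add up to d. *)

(** * Products of anticommuting elements *)

Lemma split_two_indices (I : eqType) (r : seq I) i j : i \in r -> j \in r -> i != j ->
  exists s t u, r = s ++ i :: t ++ j :: u \/ r = s ++ j :: t ++ i :: u.
Proof.
move=> ri rj nij; case/splitPr: ri rj => s r'.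
rewrite mem_cat inE (eq_sym j) (negPf nij) /= => /orP[] /splitPr[s1 s2].
  by exists s1, s2, r'; right; rewrite -catA.
by exists s, s1, s2; left.
Qed.

Section AnticommutingProducts.
Variables (A : nzRingType) (I : finType) (h : I -> A).
Hypothesis h_anticomm : forall i j, h i * h j = - (h j * h i).
Hypothesis h_sqr : forall i, h i * h i = 0.

Lemma anticomm_prodl i (s : seq I) :
  h i * \prod_(k <- s) h k = (-1) ^+ size s * (\prod_(k <- s) h k * h i).
Proof.
elim: s => [|j s IHs]; first by rewrite big_nil !mulr1 !mul1r.
rewrite !big_cons /= mulrA h_anticomm mulNr -(mulrA (h j) (h i)) IHs exprS mulN1r mulNr.
by rewrite !mulrA (commr_sign (h j)).
Qed.

(** A repeated factor can be brought next to its copy at the cost of a sign.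
Antisymmetry alone would only show that twice the product vanishes, hence the
separate hypothesis on squares. *)
Lemma prod_noninjective d (f : 'I_d -> I) : ~~ injectiveb f ->
  \prod_(k < d) h (f k) = 0.
Proof.
move=> /injectivePn[i [j nij eij]].
have mem_index k : k \in index_enum 'I_d by rewrite mem_index_enum.
have [s [t [u]]] := split_two_indices (mem_index i) (mem_index j) nij.
suff vanish : h (f i) * (\prod_(k <- t) h (f k) * h (f i)) = 0.
  case=> ->; rewrite big_cat big_cons big_cat big_cons /= -eij;
  by rewrite [X in _ * X]mulrA [X in _ * X]mulrA -(mulrA (h (f i))) vanish mul0r mulr0.
rewrite mulrA -(big_map f xpredT h) anticomm_prodl -!mulrA h_sqr !mulr0.
by [].
Qed.

(** Exchanging x and y across a product t of length p moves each of them past p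
factors, which costs (-1)^p twice, and then past the other one. *)
Lemma prod_tperm d (f : 'I_d -> I) i j : i != j ->
  \prod_(k < d) h (f (tperm i j k)) = - \prod_(k < d) h (f k).
Proof.
(* Up to exchanging i and j, i comes first in the enumeration. *)
wlog [s [t [u Dr]]] : i j / exists s t u, index_enum 'I_d = s ++ i :: t ++ j :: u.
  move=> swap nij.
  have mem_index k : k \in index_enum 'I_d by rewrite mem_index_enum.
  have [s [t [u []]]] := split_two_indices (mem_index i) (mem_index j) nij => Dr.
    by apply: swap nij; exists s, t, u.
  by rewrite tpermC; apply: swap; [exists s, t, u | rewrite eq_sym].
move=> nij; have : uniq (i :: j :: s ++ t ++ u).
  rewrite -(@perm_uniq _ (index_enum 'I_d)) ?index_enum_uniq // Dr.
  by apply/seq.permP=> p; rewrite /= !count_cat /= !count_cat /=; ring.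
rewrite /= inE !mem_cat !negb_or -!andbA => /and5P[_ nis nit niu].
case/and4P=> njs njt nju _; rewrite Dr.
have fix_off (r : seq 'I_d) : i \notin r -> j \notin r ->
    \prod_(k <- r) h (f (tperm i j k)) = \prod_(k <- r) h (f k).
  move=> ri rj; apply: eq_big_seq => k rk.
  by rewrite tpermD //; [apply: contraNneq ri | apply: contraNneq rj] => ->.
rewrite !(big_cat, big_cons) /= tpermL tpermR !fix_off //.
have swapE x y (r : seq 'I_d) :
    h x * (\prod_(k <- r) h (f k) * h y) = - (h y * (\prod_(k <- r) h (f k) * h x)).
  rewrite -(big_map f xpredT h) mulrA !anticomm_prodl.
  rewrite mulrA anticomm_prodl -!mulrA h_anticomm !mulrN.
  by [].
have regroup (x y z w : A) : x * (y * (z * w)) = x * (y * z) * w by rewrite !mulrA.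
by rewrite !(regroup (h _)) swapE mulNr mulrN.
Qed.

Lemma prod_perm d (f : 'I_d -> I) (s : 'S_d) :
  \prod_(k < d) h (f (s k)) = (-1) ^+ s * \prod_(k < d) h (f k).
Proof.
have [ts -> /allP] := prod_tpermP s; elim: ts f => [|t ts IHts] f dts.
  by rewrite big_nil odd_perm1 mul1r; apply: eq_bigr => k _; rewrite perm1.
have dt : t.1 != t.2 by apply: dts; rewrite inE eqxx.
rewrite big_cons odd_permM odd_tperm dt signr_addb expr1 mulN1r mulNr -IHts; last first.
  by move=> u tsu; apply: dts; rewrite inE tsu orbT.
rewrite -(@prod_tperm _ (f \o (\prod_(t <- ts) tperm t.1 t.2)%g)  _ _ dt).
by apply: eq_bigr => k _; rewrite permM.
Qed.

End AnticommutingProducts.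

(** * Products of linear combinations *)

Section ProductExpansion.
Variables (F : fieldType) (A : algType F) (n d : nat) (a : 'I_n.+1 -> A).
Hypothesis a_anticomm : forall i j, a i * a j = - (a j * a i).
Hypothesis a_sqr : forall i, a i * a i = 0.
Implicit Types (K : {set 'I_n.+1}) (f : {ffun 'I_d -> 'I_n.+1}).

Let entry K (k : 'I_d) : 'I_n.+1 := nth ord0 (enum K) k.

Let entry_inj K : #|K| = d -> injective (entry K).
Proof.
move=> dK k l /eqP; rewrite nth_uniq ?enum_uniq -?cardE ?dK //.
by move/eqP/val_inj.
Qed.

(** The injections with image K are the reorderings of the increasing
enumeration of K, which is what turns the sum over injections in the expansion
of a product into determinants. *)
Lemma injections_onto K : #|K| = d ->
  [set f : {ffun 'I_d -> 'I_n.+1} | injectiveb f & f @: setT == K]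
    = [set [ffun k => entry K (s k)] | s : 'S_d].
Proof.
move=> dK; apply/setP=> f; rewrite inE; apply/andP/imsetP=> [[injf /eqP imf]|[s _ ->]].
  have [g gP] : exists g : 'I_d -> 'I_d, forall k, entry K (g k) = f k.
    apply: (@fin_all_exists _ (fun _ => 'I_d) (fun k l => entry K l = f k)) => k.
    have : f k \in enum K by rewrite mem_enum -imf imset_f.
    move=> fK; have := fK; rewrite -index_mem -cardE dK => ltk.
    by exists (Ordinal ltk); rewrite /entry nth_index.
  have injg : injective g.
    by move=> k l ekl; apply: (injectiveP f injf); rewrite -!gP ekl.
  by exists (perm injg) => //; apply/ffunP=> k; rewrite ffunE permE gP.
have inj_s : injective [ffun k => entry K (s k)].
  by move=> k l; rewrite !ffunE => /(entry_inj dK) /perm_inj.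
split; first exact/injectiveP.
rewrite eqEcard card_imset // cardsT card_ord dK leqnn andbT.
apply/subsetP=> _ /imsetP[k _ ->]; rewrite ffunE.
by rewrite -mem_enum mem_nth // -cardE dK.
Qed.

(** Distributing the product gives one term for each choice function f. Those
with a repeated value vanish, and those with image K are indexed by
permutations: reordering their factors produces the signs of the Leibniz
formula. *)
Lemma prod_lincomb_minors (B : 'M[F]_(d, n.+1)) :
  \prod_(k < d) (\sum_j B k j *: a j)
    = \sum_(K in dsubsets n.+1 d)
         \det (mxsub id (fun k : 'I_d => nth ord0 (enum K) k) B)
           *: \prod_(j <- enum K) a j.
Proof.
rewrite bigA_distr_bigA.
under eq_bigr => f _ do rewrite scaler_prod.
rewrite (bigID (fun f => injectiveb f)) /= addrC big1 ?add0r; last first.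
  by move=> f ninjf; rewrite (prod_noninjective a_anticomm a_sqr) ?scaler0.
rewrite (partition_big (fun f => f @: setT) (mem (dsubsets n.+1 d))) /=; last first.
  by move=> f /injectiveP injf; rewrite inE card_imset // cardsT card_ord.
apply: eq_bigr => K; rewrite inE => /eqP dK.
transitivity (\sum_(f in [set [ffun k => entry K (s k)] | s : 'S_d])
    (\prod_k B k (f k)) *: \prod_(k < d) a (f k)).
  by apply: eq_bigl => f; rewrite -injections_onto // inE.
rewrite big_imset /=; last first.
  move=> s t _ _ /ffunP est; apply/permP=> k; have := est k.
  by rewrite !ffunE => /(entry_inj dK).
rewrite /determinant scaler_suml; apply: eq_bigr => s _.
have -> : \prod_(j <- enum K) a j = \prod_(k < d) a (entry K k).
  by rewrite (big_nth ord0) big_mkord -cardE dK.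
under [X in _ *: X]eq_bigr do rewrite ffunE.
rewrite (prod_perm a_anticomm) mulr_sign -scaler_sign scalerA mulrC.
by congr (_ * _ *: _); apply: eq_bigr => k _; rewrite !mxE ffunE.
Qed.

End ProductExpansion.

(** * The space of generators and its bases *)

Section Generators.
Variables (F : fieldType) (m : nat).
Local Notation E := (ext F m).
Local Notation W := (extpow F m 1).
Implicit Types (a b : m.-tuple E) (x y : E) (f : {linear E -> F^o}).

Lemma extpow1_xi x : x \in W -> x = \sum_k x [set k] *: tnth (xi F m) k :> E.
Proof.
move=> /mem_extpowP x1; rewrite {1}(ext_sum_extmon x).
rewrite (bigID (fun I : {set 'I_m} => I \in [set [set k] | k : 'I_m])) /=.
rewrite [X in _ + X]big1 ?addr0 => [|I nI]; last first.
  rewrite x1 ?scale0r //; apply: contra nI => /cards1P[k ->].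
  exact: imset_f.
rewrite big_imset /=; last by move=> k l _ _ /set1_inj.
by apply: eq_bigr => k _; rewrite tnth_xi.
Qed.

Lemma mem_xi k : tnth (xi F m) k \in W.
Proof.
apply/mem_extpowP=> K nK; rewrite tnth_xi ffunE.
by case: (K =P _) nK => // ->; rewrite cards1.
Qed.

Lemma extpow1_anticomm x y : x \in W -> y \in W -> x * y = - (y * x).
Proof.
move=> /extpow1_xi -> /extpow1_xi ->.
rewrite !big_distrlr exchange_big -sumrN; apply: eq_bigr => l _ /=.
rewrite -sumrN; apply: eq_bigr => k _ /=.
rewrite -!scalerAl -!scalerAr xi_anticomm !scalerN !scalerA mulrC.
by [].
Qed.

(** Proved along the sum of generators, and not from anticommutativity, so as to
hold in characteristic 2 as well. *)
Lemma extpow1_sqr x : x \in W -> x * x = 0.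
Proof.
pose P (y : E) := y \in W /\ y * y = 0.
move=> /extpow1_xi ->; apply: (proj2 (_ : P _)).
apply: (big_ind P) => [|y z [yW y0] [zW z0]|k _]; rewrite /P.
- by rewrite rpred0 mul0r.
- rewrite rpredD // mulrDl !mulrDr y0 z0 (extpow1_anticomm zW yW).
  by rewrite add0r addr0 subrr.
- by rewrite rpredZ ?mem_xi // -scalerAl -scalerAr xi_sqr !scaler0.
Qed.

Lemma basis_xi : basis_of W (xi F m).
Proof.
apply/andP; split.
  rewrite eqEsubv; apply/andP; split.
    by apply/span_subvP=> x /tnthP[k ->]; apply: mem_xi.
  apply/subvP=> x /extpow1_xi ->; apply: rpred_sum => k _.
  by apply/rpredZ/memv_span/mem_tnth.
have nth_xi (l : 'I_m) : (xi F m)`_l = extmon F [set l] by rewrite -tnth_nth tnth_xi.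
apply/freeP=> c c0 k; move/ffunP/(_ [set k]): c0.
rewrite sum_ffunE (bigD1 k) //= big1 => [|l nlk].
  by have /= -> := nth_xi k; rewrite !ffunE eqxx /GRing.scale /= mulr1 addr0.
have /= -> := nth_xi l; rewrite !ffunE (inj_eq set1_inj) eq_sym (negPf nlk).
by rewrite scaler0.
Qed.

Lemma basis_change a b (N : 'M[F]_m) : basis_of W a ->
  (forall i, tnth b i \in W) ->
  (forall i, tnth a i = \sum_j N i j *: tnth b j) -> basis_of W b.
Proof.
move=> aW bW aE; rewrite basisEdim size_tuple (size_basis aW) leqnn andbT.
rewrite -(span_basis aW); apply/span_subvP=> x /tnthP[i ->].
rewrite aE; apply: rpred_sum => j _.
by apply/rpredZ/memv_span/mem_tnth.
Qed.

Lemma contractionD f x y : contraction f (x + y) = contraction f x + contraction f y.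
Proof.
apply/ffunP=> K; rewrite !ffunE -big_split; apply: eq_bigr => k _ /=.
by rewrite ffunE mulrDr.
Qed.

Lemma contractionZ f (c : F) x : contraction f (c *: x) = c *: contraction f x.
Proof.
apply/ffunP=> K; rewrite !ffunE scaler_sumr; apply: eq_bigr => k _ /=.
by rewrite ffunE /GRing.scale /=; ring.
Qed.

(** The Leibniz rule of a left superderivation, for a first factor of degree 1:
both sides are linear in that factor, so the case of a generator suffices. *)
Lemma contraction_extpow1_mul f x y : x \in W ->
  contraction f (x * y) = f x *: y - x * contraction f y.
Proof.
move=> /extpow1_xi ->; rewrite mulr_suml linear_sum scaler_suml mulr_suml.
rewrite -sumrB.
elim/big_rec2: _ => [|k u v _ <-].
  apply/ffunP=> K; rewrite !ffunE big1 // => k _; rewrite ffunE mulr0 //.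
rewrite contractionD -scalerAl contractionZ contraction_xi_mul.
by rewrite linearZ /= scalerBr !scalerA -scalerAl.
Qed.

(** The Leibniz rule is applied to the factors of b_I one after the other. A factor
b_j with j <> i passes through b_i \partial_(b_i) unchanged, as the two
signs cancel; the factor b_i is restored by the operator, and the remaining
term is killed by b_i b_i = 0. *)
Lemma diag_wedge b i I : basis_of W b ->
  tnth b i * partial b i (wedge b I) = (i \in I)%:R *: wedge b I.
Proof.
move=> bW.
have bI j : tnth b j \in W by rewrite (basis_mem bW) ?mem_tnth.
have dual j : coord b i (tnth b j) = (i == j)%:R.
  by rewrite (tnth_nth 0) coord_free ?(basis_free bW) // eq_sym.
rewrite /wedge -(mem_enum I); elim: (enum I) (enum_uniq I) => [_|j s IHs /=].
  by rewrite big_nil /partial contraction1 mulr0 scale0r.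
case/andP=> njs /IHs {}IHs.
rewrite big_cons /partial contraction_extpow1_mul //= dual inE.
rewrite mulrBr mulrA; case: eqP => [<-|_] /=.
  by rewrite extpow1_sqr // mul0r subr0 !scale1r.
rewrite scale0r mulr0 sub0r (extpow1_anticomm (bI i) (bI j)) mulNr opprK -mulrA IHs.
by rewrite scalerAr.
Qed.

End Generators.

(** * Transposes and linear forms *)

(** The transposed matrix of X acts on the values of a linear form at the basis
vectors as precomposition with X. Representing the form l by the vector
\sum_j l(e_j) e_j thus turns the relation l \o X = c l into an
eigenvector equation for the transpose. *)
Lemma transpose_op_eigenform (F : fieldType) (vT : vectType F) k
    (e : k.-tuple vT) (X : 'End(vT)) (l : {linear vT -> F^o}) (c : F) :
  basis_of fullv e -> (forall v, l (X v) = c * l v) ->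
  transpose_op e X (\sum_j (l (tnth e j) : F) *: tnth e j)
    = c *: \sum_j (l (tnth e j) : F) *: tnth e j.
Proof.
move=> eB lX; rewrite /transpose_op linear_sum scaler_sumr /=.
under eq_bigr => j _ do rewrite linearZ /= mx_op_basis // scaler_sumr.
rewrite exchange_big; apply: eq_bigr => i _ /=.
rewrite scalerA -lX [in RHS](coord_basis eB (memvf (X (tnth e i)))) linear_sum.
rewrite scaler_suml; apply: eq_bigr => j _.
by rewrite scalerA !mxE linearZ /= -tnth_nth mulrC.
Qed.

(** * Changing generators in an exterior power *)

Section ChangeOfGenerators.
Variables (F : fieldType) (n d : nat).
Local Notation E := (ext F n.+1).
Local Notation W := (extpow F n.+1 1).
Implicit Types (a b : n.+1.-tuple E) (M : 'M[F]_n.+1) (I K S : {set 'I_n.+1}).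

Lemma wedge_minors a b M I : I \in dsubsets n.+1 d ->
  (forall i, tnth a i \in W) ->
  (forall i, tnth b i = \sum_j M i j *: tnth a j) ->
  wedge b I = \sum_(K in dsubsets n.+1 d) minor d M I K *: wedge a K.
Proof.
rewrite inE => /eqP dI aW bE.
have -> : wedge b I = \prod_(k < d) \sum_j
    (mxsub (fun k : 'I_d => nth ord0 (enum I) k) id M) k j *: tnth a j.
  rewrite /wedge (big_nth ord0) big_mkord -cardE dI.
  by apply: eq_bigr => k _; rewrite bE; apply: eq_bigr => j _; rewrite mxE.
rewrite prod_lincomb_minors => [|i j|i]; last 2 first.
- exact: extpow1_anticomm.
- exact: extpow1_sqr.
apply: eq_bigr => K _; congr (\det _ *: _).
by apply/matrixP=> i j; rewrite !mxE.
Qed.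

Lemma wedge_pow_minors a b M I : I \in dsubsets n.+1 d ->
  (forall i, tnth a i \in W) ->
  (forall i, tnth b i = \sum_j M i j *: tnth a j) ->
  wedge_pow b d I = \sum_(K in dsubsets n.+1 d) minor d M I K *: wedge_pow a d K.
Proof.
move=> dI aW bE; rewrite /wedge_pow (wedge_minors dI aW bE) linear_sum.
by apply: eq_bigr => K _; rewrite linearZ.
Qed.

(** Each xi_I is a combination of the b_K by [wedge_minors], so these span, and
there are as many of them as of the xi_I. *)
Lemma basis_pow b : basis_of W b -> basis_of fullv (pow_basis b d).
Proof.
move=> bW; have xiB := pow_basis_xi F n.+1 d.
have bI j : tnth b j \in W by rewrite (basis_mem bW) ?mem_tnth.
rewrite basisEdim size_tuple (size_basis xiB) leqnn andbT.
rewrite -(span_basis xiB); apply/span_subvP=> _ /mapP[I dI ->].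
rewrite mem_enum in dI.
rewrite (@wedge_pow_minors b _ (\matrix_(i, j) coord b j (tnth (xi F n.+1) i)) I dI bI).
  apply: rpred_sum => K dK; apply/rpredZ/memv_span.
  by apply: map_f; rewrite mem_enum.
move=> i; rewrite {1}(coord_basis bW (mem_xi F i)).
by apply: eq_bigr => j _; rewrite mxE -tnth_nth.
Qed.

Lemma tnth_pow_basis b k :
  tnth (pow_basis b d) k = wedge_pow b d (enum_val k).
Proof. by rewrite tnth_map (tnth_nth set0) -enum_val_nth. Qed.

Lemma diag_op_wedge_pow b i I : basis_of W b -> I \in dsubsets n.+1 d ->
  diag_op b d i (wedge_pow b d I) = (i \in I)%:R *: wedge_pow b d I.
Proof.
move=> bW dI; have bI j : tnth b j \in W by rewrite (basis_mem bW) ?mem_tnth.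
(* [diag_op] is [linfun] of a plain function, to be shown linear first. *)
pose f (v : subvs_of (extpow F n.+1 d)) :=
  vsproj (extpow F n.+1 d) (tnth b i * partial b i (vsval v)).
have fL : linear f.
  move=> c u v; rewrite /f /partial linearP contractionD contractionZ.
  by rewrite mulrDr -scalerAr linearP.
pose fM := GRing.semilinear_linear fL.
pose g : {linear _ -> _} := HB.pack f (GRing.isSemilinear.Build F _ _ _ f fM).
rewrite /diag_op (lfunE g) /= /f vsprojK; last first.
  by move: dI; rewrite inE => /eqP <-; apply: mem_wedge.
by rewrite diag_wedge // linearZ.
Qed.

Lemma coord_diag_op a i (k : 'I_#|dsubsets n.+1 d|) v : basis_of W a ->
  coord (pow_basis a d) k (diag_op a d i v)
    = (i \in enum_val k)%:R * coord (pow_basis a d) k v.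
Proof.
move=> aW; have aB := basis_pow aW.
rewrite {1}(coord_basis aB (memvf v)) !linear_sum (bigD1 k) //= big1 => [|l nlk].
  rewrite -tnth_nth tnth_pow_basis !linearZ /= diag_op_wedge_pow ?enum_valP //.
  rewrite linearZ /= -tnth_pow_basis (tnth_nth 0) coord_free ?(basis_free aB) //.
  by rewrite eqxx addr0 mulr1 mulrC.
rewrite -tnth_nth tnth_pow_basis !linearZ /= diag_op_wedge_pow ?enum_valP //.
rewrite linearZ /= -tnth_pow_basis (tnth_nth 0) coord_free ?(basis_free aB) //.
by rewrite (negPf nlk) !mulr0.
Qed.

(** By [wedge_pow_minors], the minor of M on I and S is the value at b_I of the
coordinate form of a_S, which is an eigenform of the diagonal operator. *)
Lemma transpose_diag_op_minors a b M i S : basis_of W a -> basis_of W b ->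
  (forall i, tnth b i = \sum_j M i j *: tnth a j) -> S \in dsubsets n.+1 d ->
  let v := \sum_(I in dsubsets n.+1 d) minor d M I S *: wedge_pow b d I in
  transpose_op (pow_basis b d) (diag_op a d i) v = (i \in S)%:R *: v.
Proof.
move=> aW bW bE dS v; have aB := basis_pow aW; have bB := basis_pow bW.
have aI j : tnth a j \in W by rewrite (basis_mem aW) ?mem_tnth.
pose k := enum_rank_in dS S; have Sk : enum_val k = S by apply: enum_rankK_in.
have -> : v = \sum_j coord (pow_basis a d) k (tnth (pow_basis b d) j)
                       *: tnth (pow_basis b d) j.
  rewrite /v big_enum_val; apply: eq_bigr => j _; rewrite tnth_pow_basis.
  congr (_ *: _); rewrite (wedge_pow_minors (enum_valP j) aI bE) linear_sum.
  rewrite big_enum_val (bigD1 k) //= big1 => [|l nlk].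
    rewrite addr0 linearZ /= -tnth_pow_basis (tnth_nth 0).
    by rewrite coord_free ?(basis_free aB) // eqxx mulr1 Sk.
  rewrite linearZ /= -tnth_pow_basis (tnth_nth 0).
  by rewrite coord_free ?(basis_free aB) // (negPf nlk) mulr0.
apply: (transpose_op_eigenform bB) => w.
by have := coord_diag_op i k w aW; rewrite Sk.
Qed.

End ChangeOfGenerators.

(** * Krawtchouk polynomials as eigenvectors *)

Section Minors.
Variables (K : comNzRingType) (n d : nat).
Implicit Types (A : 'M[K]_n.+1) (r : 'rV[K]_n.+1) (I J : {set 'I_n.+1}).

Lemma minor_mul_diag A r I J :
  minor d (A *m diag_mx r) I J
    = minor d A I J * \prod_(k < d) r 0 (nth ord0 (enum J) k).
Proof.
rewrite /minor mul_mx_diag.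
set rJ := \row_(k < d) r 0 (nth ord0 (enum J) k).
have -> : \prod_(k < d) r 0 (nth ord0 (enum J) k) = \det (diag_mx rJ).
  by rewrite det_diag; apply: eq_bigr => k _; rewrite mxE.
rewrite -det_mulmx mul_mx_diag; congr (\det _).
by apply/matrixP=> i j; rewrite !mxE.
Qed.

Lemma minor_tr A I J : minor d A^T I J = minor d A J I.
Proof. by rewrite /minor -trmx_mxsub det_tr. Qed.

End Minors.

(** Inverting the matrix of a family of linear combinations; the hypothesis is
stated with an explicit left inverse N so that the diagonal factor of N stays
visible. *)
Lemma lincomb_mulmx (F : fieldType) (E : lmodType F) m (a b : 'I_m -> E)
    (M N : 'M[F]_m) :
  (forall i, b i = \sum_j M i j *: a j) -> N *m M = 1%:M ->
  forall i, a i = \sum_j N i j *: b j.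
Proof.
move=> bE NM i; under eq_bigr => j _ do rewrite bE scaler_sumr.
rewrite exchange_big; transitivity (\sum_k (N *m M) i k *: a k); last first.
  by apply: eq_bigr => k _; rewrite mxE scaler_suml; apply: eq_bigr => j _; rewrite scalerA.
rewrite NM (bigD1 i) //= mxE eqxx scale1r big1 ?addr0 // => k nki.
by rewrite mxE eq_sym (negPf nki) scale0r.
Qed.

Lemma basis_lincomb (F : fieldType) m (a b : m.-tuple (ext F m)) (M : 'M[F]_m) :
  basis_of (extpow F m 1) a -> M \in unitmx ->
  (forall i, tnth b i = \sum_j M i j *: tnth a j) ->
  basis_of (extpow F m 1) b.
Proof.
move=> aW uM bE.
have aE := lincomb_mulmx bE (mulVmx uM); apply: (basis_change aW _ aE) => i.
rewrite bE; apply: rpred_sum => j _; apply: rpredZ.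
by rewrite (basis_mem aW) ?mem_tnth.
Qed.

(** The form in which the Krawtchouk polynomials meet the change of generators:
their coefficients are minors of V, whereas the change of generators has the
matrix V with its columns scaled. On the fixed column set S this scaling is a
constant, nonzero since the matrix is invertible. *)
Lemma transpose_diag_op_scaled_minors (F : fieldType) n d
    (a b : n.+1.-tuple (ext F n.+1)) (A : 'M[F]_n.+1) (r : 'rV[F]_n.+1) (c : F)
    i (S : {set 'I_n.+1}) :
  basis_of (extpow F n.+1 1) a -> A *m diag_mx r \in unitmx ->
  (forall i, tnth b i = \sum_j (A *m diag_mx r) i j *: tnth a j) ->
  S \in dsubsets n.+1 d ->
  let v := \sum_(I in dsubsets n.+1 d) (c * minor d A I S) *: wedge_pow b d I in
  transpose_op (pow_basis b d) (diag_op a d i) v = (i \in S)%:R *: v.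
Proof.
move=> aW uM bE dS v; have bW := basis_lincomb aW uM bE.
pose p := \prod_(k < d) r 0 (nth ord0 (enum S) k).
have p_neq0 : p != 0.
  apply/prodf_neq0 => k _; move: uM.
  rewrite unitmx_mul => /andP[_]; rewrite unitmxE det_diag unitfE => /prodf_neq0.
  exact.
have -> : v = (c / p) *: \sum_(I in dsubsets n.+1 d)
                 minor d (A *m diag_mx r) I S *: wedge_pow b d I.
  rewrite scaler_sumr; apply: eq_bigr => I _.
  by rewrite scalerA minor_mul_diag -/p mulrCA mulrA -mulrA mulfVK // mulrC.
by rewrite linearZ /= (transpose_diag_op_minors i aW bW bE dS) !scalerA mulrC.
Qed.

Section KrawtchoukAtBits.
Variables (F : fieldType) (n d : nat) (V : 'M[F]_n.+1).
Variable eps : {ffun 'I_n.+1 -> bool}.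
Hypothesis eps_d : (\sum_(i < n.+1) eps i)%N = d.
Local Notation S := [set i | eps i].

Lemma support_dsubsets : S \in dsubsets n.+1 d.
Proof. by rewrite inE -eps_d cardsE -sum1_card big_mkcond. Qed.

(** The monomial indexed by J, evaluated at the indicator of S, tests J \subset S,
which is J = S since both have d elements. *)
Lemma prod_bits (K : comNzRingType) J : J \in dsubsets n.+1 d ->
  \prod_(j in J) bits K eps 0 j = (J == S)%:R.
Proof.
rewrite inE => /eqP dJ.
have := support_dsubsets; rewrite inE => /eqP dS.
rewrite eqEcard dJ dS leqnn andbT.
have [sJS|/subsetPn[j jJ]] := boolP (J \subset S).
  by rewrite big1 // => j /(subsetP sJS); rewrite inE mxE => ->.
by rewrite inE => /negPf ej; rewrite (bigD1 j) //= mxE ej mul0r.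
Qed.

Lemma krawtchouk_bitsr (K : comAlgType F) (te : 'rV[K]_n.+1) :
  krawtchouk d V (bits K eps) te
    = \sum_(I in dsubsets n.+1 d)
        (d`!%:R^-1 * minor d V I S) *: \prod_(i in I) te 0 i.
Proof.
rewrite krawtchouk_minors; apply: eq_bigr => I _.
rewrite (bigD1 S) ?support_dsubsets //= prod_bits ?support_dsubsets //.
rewrite eqxx mulr1 [X in _ + X]big1 ?addr0 // => J /andP[dJ /negPf nJS].
by rewrite prod_bits // nJS mulr0 scaler0.
Qed.

Lemma krawtchouk_bitsl (K : comAlgType F) (e : 'rV[K]_n.+1) :
  krawtchouk d V e (bits K eps)
    = \sum_(J in dsubsets n.+1 d)
        (d`!%:R^-1 * minor d V^T J S) *: \prod_(j in J) e 0 j.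
Proof.
rewrite krawtchouk_minors exchange_big; apply: eq_bigr => J _ /=.
rewrite (bigD1 S) ?support_dsubsets //= prod_bits ?support_dsubsets //.
rewrite eqxx mul1r minor_tr [X in _ + X]big1 ?addr0 // => I /andP[dI /negPf nIS].
by rewrite prod_bits // nIS mul0r scaler0.
Qed.

Lemma tkraw_wedge_minors kappa tq :
  tkraw_wedge kappa tq V d eps
    = \sum_(I in dsubsets n.+1 d)
        (d`!%:R^-1 * minor d V I S) *: wedge_pow (txi kappa tq V) d I.
Proof.
rewrite /tkraw_wedge krawtchouk_bitsr -psi_multilinear; congr psi.
by apply: eq_bigr => I _; under eq_bigr do rewrite mxE.
Qed.

Lemma kraw_wedge_minors :
  kraw_wedge V d eps
    = \sum_(J in dsubsets n.+1 d)
        (d`!%:R^-1 * minor d V^T J S) *: wedge_pow (xi F n.+1) d J.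
Proof.
rewrite /kraw_wedge krawtchouk_bitsl -psi_multilinear; congr psi.
by apply: eq_bigr => I _; under eq_bigr do rewrite mxE.
Qed.

(** The eigenvalues eps_i add up to d, so removing those with i <> 0 from d leaves
eps_0. *)
Lemma complementary_eigenvalue (vT : vectType F) (X : 'I_n.+1 -> 'End(vT)) v :
  (forall i, X i v = (eps i)%:R *: v) ->
  (d%:R *: \1 - \sum_(i < n.+1 | i != 0) X i)%VF v = (eps 0)%:R *: v.
Proof.
move=> Xv; rewrite add_lfunE opp_lfunE scale_lfunE id_lfunE sum_lfunE.
under eq_bigr => i _ do rewrite Xv.
rewrite -scaler_suml -scalerBl; congr (_ *: _).
rewrite -eps_d natr_sum (bigD1 0) //=.
by rewrite addrK.
Qed.

End KrawtchoukAtBits.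

Theorem proposition4p8 (R : realType) (n : nat)
    (q tq : 'rV[R[i]]_n.+1) (V : 'M[R[i]]_n.+1)
    (q0_eq : q 0 0 = tq 0 0) (q0_neq0 : q 0 0 != 0)
    (V_row0 : forall j : 'I_n.+1, V 0 j = 1)
    (V_col0 : forall i : 'I_n.+1, V i 0 = 1)
    (QVQV : diag_mx q *m V *m diag_mx tq *m V^T = (q 0 0)%:M)
    (kappa : R[i])
    (kappa_det : \det (kappa *: (diag_mx tq *m V^T)) = 1)
    (d : nat) (d_le : (d <= n.+1)%N)
    (eps teps : {ffun 'I_n.+1 -> bool})
    (eps_d : (\sum_(i < n.+1) eps i)%N = d)
    (teps_d : (\sum_(i < n.+1) teps i)%N = d) :
  let xi_basis := pow_basis (xi R[i] n.+1) d in
  let txi_basis := pow_basis (txi kappa tq V) d in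
  let D := diag_op (xi R[i] n.+1) d in
  let tD := diag_op (txi kappa tq V) d in
  let tP := tkraw_wedge kappa tq V d eps in
  let P := kraw_wedge V d teps in
  [/\ forall i : 'I_n.+1,
        transpose_op txi_basis (D i) tP = (eps i)%:R *: tP,
      forall i : 'I_n.+1,
        transpose_op xi_basis (tD i) P = (teps i)%:R *: P,
      (d%:R *: \1 - \sum_(i < n.+1 | i != 0) transpose_op txi_basis (D i))%VF tP
        = (eps 0)%:R *: tP
    & (d%:R *: \1 - \sum_(i < n.+1 | i != 0) transpose_op xi_basis (tD i))%VF P
        = (teps 0)%:R *: P].
Proof.
move=> xi_basis txi_basis D tD tP P.
pose T := V *m diag_mx (kappa *: tq).
pose T' := V^T *m diag_mx ((kappa * q 0 0)^-1 *: q).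
(* A matrix of positive size scaled by 0 has determinant 0. *)
have kappa_neq0 : kappa != 0.
  apply/eqP=> k0; move/eqP: kappa_det.
  by rewrite k0 detZ expr0n mul0r eq_sym oner_eq0.
have diag_mxZ (c : R[i]) r : diag_mx (c *: r) = c *: diag_mx r :> 'M_n.+1.
  by rewrite linearZ.
(* The orthogonality relation, with diag(q) moved to the right-hand end. *)
have TT' : T *m T' = 1%:M.
  have QV : ((q 0 0)^-1 *: diag_mx q) *m (V *m diag_mx tq *m V^T) = 1%:M.
    by rewrite -scalemxAl !mulmxA QVQV scale_scalar_mx mulVf.
  rewrite -(mulmx1C QV) /T /T' !diag_mxZ -!(scalemxAl, scalemxAr) !mulmxA.
  by rewrite !scalerA invfM mulrA mulfV // mul1r.
have T'T := mulmx1C TT'; have [uT uT'] := mulmx1_unit TT'.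
have txiE i : tnth (txi kappa tq V) i = \sum_j T i j *: tnth (xi R[i] n.+1) j.
  rewrite tnth_mktuple scaler_sumr; apply: eq_bigr => j _.
  by rewrite scalerA /T mul_mx_diag !mxE; congr (_ *: _); rewrite mulrA mulrC.
have xiE := lincomb_mulmx txiE T'T.
have txiW := basis_lincomb (basis_xi _ _) uT txiE.
have tPE i : transpose_op txi_basis (D i) tP = (eps i)%:R *: tP.
  rewrite /tP (tkraw_wedge_minors V eps_d).
  by rewrite (transpose_diag_op_scaled_minors _ _ (basis_xi _ _) uT txiE) ?support_dsubsets ?inE.
have PE i : transpose_op xi_basis (tD i) P = (teps i)%:R *: P.
  rewrite /P (kraw_wedge_minors V teps_d).
  by rewrite (transpose_diag_op_scaled_minors _ _ txiW uT' xiE) ?support_dsubsets ?inE.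
split=> //; exact: complementary_eigenvalue.
Qed.
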